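(* Let $\{\mathcal{S}(t)\}_{t\ge0}$ be the generalized Skellam process, let $\{Y(t)\}_{t\ge0}$ be an independent inverse Gaussian subordinator with parameters $\delta>0$ and $\gamma>0$, and let $p_{f_3}(n,t)=\Pr\{\mathcal{S}(Y(t))=n\}$, $n\in\mathbb{Z}$. Then $$\Big(\frac{\mathrm{d}^2}{\mathrm{d}t^2}-2\delta\gamma\frac{\mathrm{d}}{\mathrm{d}t}\Big)p_{f_3}(n,t)=-2\delta^2\Big(\Lambda\big(p_{f_3}(n-1,t)-p_{f_3}(n,t)\big)-\bar\Lambda\big(p_{f_3}(n,t)-p_{f_3}(n+1,t)\big)\Big).$$
   Context: Fix an integer $k\ge1$ and positive rates $\lambda_1,\dots,\lambda_k,\mu_1,\dots,\mu_k$; $\Lambda=\lambda_1+\dots+\lambda_k$, $\bar\Lambda=\mu_1+\dots+\mu_k$. The generalized counting process (GCP) with rates $\lambda_1,\dots,\lambda_k$ is a Lévy process started at $0$ performing jumps of size $j\in\{1,\dots,k\}$ at rate $\lambda_j$. The generalized Skellam process (GSP) is $\mathcal{S}(t)=M_1(t)-M_2(t)$, with $M_1,M_2$ independent GCPs with rates $\lambda_j$ and $\mu_j$, respectively. The paper uses throughout that the state probabilities $p(n,t)=\Pr\{\mathcal{S}(t)=n\}$ satisfy $\frac{\mathrm{d}}{\mathrm{d}t}p(n,t)=\Lambda(p(n-1,t)-p(n,t))-\bar\Lambda(p(n,t)-p(n+1,t))$, $n\in\mathbb{Z}$, with $p(0,0)=1$, $p(n,0)=0$ for $n\ne0$. The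 inverse Gaussian subordinator $Y$ is the Lévy subordinator with $\mathbb{E}(e^{-sY(t)})=e^{-tf_3(s)}$, $f_3(s)=\delta(\sqrt{2s+\gamma^2}-\gamma)$, $s>0$; its density is $q(x,t)=(2\pi)^{-1/2}\delta t x^{-3/2}\exp\big(\delta\gamma t-\tfrac12(\delta^2t^2x^{-1}+\gamma^2x)\big)$, $x>0$.
   Formalization: The system for p(n,t) is a hypothesis, since for k≥2 the literal generalized Skellam process does not satisfy it; the equation (t>0) is also stated for any integer-valued right-continuous process whose state probabilities solve the system with rates Λ, Λ̄. *)

(* Defs.v *)
From HB Require Import structures.
From mathcomp Require Export all_boot all_order all_algebra.
From mathcomp Require Export all_classical all_reals all_analysis.
Export Order.TTheory GRing.Theory Num.Theory.
Export numFieldNormedType.Exports.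

Set Implicit Arguments.
Unset Strict Implicit.
Unset Printing Implicit Defensive.

Local Open Scope classical_set_scope.
Local Open Scope ring_scope.

(* A stochastic process on T is a function X : R -> T -> R, where X t w is only
   meaningful for 0 <= t.  Path properties (starting point, regularity,
   monotonicity, integer values) are required for every w, so that the
   subordinated process S (Y t w) w never looks at a negative time. *)

Section Processes.
Context {R : realType} {d : measure_display} {T : measurableType d}.
Implicit Types (P : probability T R) (X S Y M : R -> T -> R).

Definition measurable_process X : Prop :=
  forall t : R, 0 <= t -> measurable_fun [set: T] (X t).

Definition right_continuous X : Prop :=
  forall w (t : R), 0 <= t -> X s w @[s --> t^'+] --> X t w.

Definition cadlag X : Prop :=
  right_continuous X /\
  forall w (t : R), 0 < t -> cvg (X s w @[s --> t^'-]).

Definition independent_increments P X : Prop :=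
  forall (n : nat) (t : nat -> R) (B : nat -> set R),
    0 <= t 0%N -> (forall i, (i < n)%N -> t i <= t i.+1) ->
    (forall i, measurable (B i)) ->
    P (\bigcap_(i in `I_n) [set w | B i (X (t i.+1) w - X (t i) w)]) =
    (\prod_(0 <= i < n) P [set w | B i (X (t i.+1) w - X (t i) w)%R])%E.

Definition stationary_increments P X : Prop :=
  forall (s t : R) (B : set R), 0 <= s -> 0 <= t -> measurable B ->
    P [set w | B (X (s + t) w - X s w)] = P [set w | B (X t w)].

Record levy_process P X : Prop := LevyProcess {
  levy_measurable : measurable_process X;
  levy_start : forall w, X 0 w = 0;
  levy_independent : independent_increments P X;
  levy_stationary : stationary_increments P X;
  levy_cadlag : cadlag X }.

Definition process_events X : set (set T) :=
  [set A | exists (t : R) (B : set R), [/\ 0 <= t, measurable B & A = X t @^-1` B]].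

Definition independent_processes P X Y : Prop :=
  forall A B : set T, <<s process_events X >> A -> <<s process_events Y >> B ->
    P (A `&` B) = (P A * P B)%E.

Definition state_prob P X (n : int) (t : R) : R :=
  fine (P [set w | X t w = n%:~R]).

(* The jumps of size j occur at rate lam_j in the sense of the infinitesimal
   transition probabilities P(M(h) = j) = lam_j h + o(h) for 1 <= j <= k and
   P(M(h) = 0) = 1 - Lam h + o(h); the index i : 'I_k stands for j = i + 1. *)
Record generalized_counting_process P (k : nat) (lam : 'I_k -> R) M : Prop :=
  GeneralizedCountingProcess {
  gcp_levy : levy_process P M;
  gcp_nat : forall (t : R) w, 0 <= t -> exists n : nat, M t w = n%:R;
  gcp_jump : forall i : 'I_k,
    state_prob P M (i.+1)%:Z h / h @[h --> 0^'+] --> lam i;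
  gcp_stay :
    (1 - state_prob P M 0 h) / h @[h --> 0^'+] --> \sum_(i < k) lam i }.

Definition generalized_skellam_process P (k : nat) (lam mu : 'I_k -> R) S :
    Prop :=
  exists M1 M2, [/\ generalized_counting_process P lam M1,
    generalized_counting_process P mu M2,
    independent_processes P M1 M2 &
    S = fun t w => M1 t w - M2 t w].

(* At time 0 only the initial values are prescribed: p n is not specified at
   negative times, so the derivative is required for t > 0. *)
Definition skellam_system (Lam Lambar : R) (p : int -> R -> R) : Prop :=
  [/\ p 0 0 = 1, (forall n : int, n != 0 -> p n 0 = 0) &
    forall (n : int) (t : R), 0 < t ->
      is_derive t 1 (p n)
        (Lam * (p (n - 1) t - p n t) - Lambar * (p n t - p (n + 1) t))].

Definition integer_valued S : Prop :=
  forall (t : R) w, 0 <= t -> exists n : int, S t w = n%:~R.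

Definition subordinator P Y : Prop :=
  levy_process P Y /\ forall w (s t : R), 0 <= s -> s <= t -> Y s w <= Y t w.

Definition ig_exponent (delta gamma s : R) : R :=
  delta * (Num.sqrt (2 * s + gamma ^+ 2) - gamma).

Definition inverse_gaussian_subordinator P (delta gamma : R) Y : Prop :=
  subordinator P Y /\
  forall s t : R, 0 < s -> 0 <= t ->
    ('E_P[fun w => expR (- s * Y t w)] =
     (expR (- t * ig_exponent delta gamma s))%:E)%E.

Definition subordinated S Y : R -> T -> R := fun t w => S (Y t w) w.

End Processes.

(* Main.v *)
Require Import Defs.
From mathcomp Require Import ring lra zify measurable_realfun.

(** Write [l = sqrt Lam], [m = sqrt Lambar]. Setting [p n t = (l / m)^n r n t]
    makes the generator of the Skellam system symmetric, and a Fourier transform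
    diagonalizes it with real nonnegative symbol
    [c x = l^2 + m^2 - 2 l m cos x]; hence
      [p n t = (l / m)^n * (1 / pi) int_0^pi cos (n x) exp (- t c x) dx],
    by uniqueness of the solutions of the system in a weighted sup norm.
    Conditioning on [Y t] replaces [exp (- t c x)] by its expectation
    [exp (- t f (c x))], [f] being the Laplace exponent of [Y], and one
    differentiates under the integral: the equation reduces to the identity
    [f s ^ 2 + 2 delta gamma f s = 2 delta^2 s]. Only the Laplace transform of
    [Y t] is needed, not its density. *)

Set Implicit Arguments.
Unset Strict Implicit.
Unset Printing Implicit Defensive.

Local Open Scope classical_set_scope.
Local Open Scope ring_scope.

(** * Differentiation of exponential mixtures under the integral sign *)

Lemma exp_mixture_le (R : realType) (U : Type) (g h : U -> R) (A B C t : R) :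
  (forall x, `|g x| <= A) -> (forall x, 0 <= h x <= B) -> `|t| <= C ->
  forall x, `|g x * expR (- (t * h x))| <= A * expR (C * B).
Proof.
move=> gA hB tC x; have /andP[h0 hxB] := hB x.
rewrite normrM; apply: ler_pM => //; rewrite ger0_norm ?expR_ge0// ler_expR.
apply: (le_trans (ler_norm _)); rewrite normrN normrM.
by apply: ler_pM => //; rewrite ger0_norm.
Qed.

Section ExponentialMixture.
Context {R : realType} {d : measure_display} {U : measurableType d}.
Variable nu : probability U R.

Lemma integrable_le_cst (f : U -> R) (C : R) :
  measurable_fun [set: U] f -> (forall x, `|f x| <= C) ->
  nu.-integrable [set: U] (EFin \o f).
Proof.
move=> mf fC; apply: measurable_bounded_integrable => //.
  by apply: (le_lt_trans (probability_le1 nu measurableT)); rewrite ltry.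
exists C; split; first exact: num_real.
by move=> M CM x _; apply: (le_trans (fC x)); exact: ltW.
Qed.

Lemma normr_Rintegral_le_cst (f : U -> R) (C : R) :
  measurable_fun [set: U] f -> (forall x, `|f x| <= C) ->
  `|\int[nu]_x f x| <= C.
Proof.
move=> mf fC; have fi := integrable_le_cst mf fC.
apply: (le_trans (le_normr_Rintegral _ fi)) => //.
have -> : C = \int[nu]_x (cst C x).
  by rewrite Rintegral_cst// [X in fine X](probability_setT nu) mulr1.
apply: le_Rintegral => //; first exact: integrable_norm.
apply: (@integrable_le_cst _ `|C|) => //; exact: measurable_cst.
Qed.

Lemma measurable_exp_mixture (g h : U -> R) (t : R) :
  measurable_fun [set: U] g -> measurable_fun [set: U] h ->
  measurable_fun [set: U] (fun x => g x * expR (- (t * h x))).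
Proof.
move=> mg mh; apply: measurable_funM => //; apply: measurableT_comp => //.
by apply: measurableT_comp => //; apply: measurable_funM.
Qed.

(** Since [h] is bounded, for [s] within distance 1 of [t] the derivative of the integrand is
    dominated by a constant, which is integrable for a probability. No sign condition on [t] is
    required. *)
Lemma is_derive_exp_mixture (g h : U -> R) (A B t : R) :
  measurable_fun [set: U] g -> measurable_fun [set: U] h ->
  (forall x, `|g x| <= A) -> (forall x, 0 <= h x <= B) ->
  is_derive t 1 (fun s => \int[nu]_x (g x * expR (- (s * h x))))
    (- \int[nu]_x (g x * h x * expR (- (t * h x)))).
Proof.
move=> mg mh gA hB.
pose f (s : R) (x : U) := g x * expR (- (s * h x)).
have df (s : R) x : is_derive s 1 (f ^~ x) (- (g x * h x * expR (- (s * h x)))).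
  rewrite /f; apply: is_derive_eq.
  by rewrite /GRing.scale/=; ring.
have d1 (s : R) x : partial1of2 f s x = - (g x * h x * expR (- (s * h x))).
  by rewrite partial1of2E derive_val.
have mghe s : measurable_fun [set: U] (fun x => g x * h x * expR (- (s * h x))).
  by apply: measurable_exp_mixture => //; apply: measurable_funM.
have ghAB x : `|g x * h x| <= A * B.
  have /andP[h0 hxB] := hB x.
  by rewrite normrM; apply: ler_pM => //; rewrite ger0_norm.
pose I : set R := [set` `]t - 1, t + 1[].
have It s : I s -> `|s| <= `|t| + 1.
  rewrite /I/= in_itv/= => /andP[ts st].
  have : `|s - t| <= 1 by rewrite ler_norml; apply/andP; split; lra.
  by move=> st1; have := ler_normD (s - t) t; rewrite subrK; lra.
have tI : I t by rewrite /I/= in_itv/=; apply/andP; split; lra.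
(* The absolute value makes the dominating constant nonnegative without a discussion of the signs of
   [A] and [B]. *)
pose G : U -> R := cst (`|A * B * expR ((`|t| + 1) * B)|).
have intf s : I s -> nu.-integrable [set: U] (EFin \o f s).
  move=> Is; apply: integrable_le_cst; first exact: measurable_exp_mixture.
  exact: (exp_mixture_le gA hB (It s Is)).
have intG : nu.-integrable [set: U] (EFin \o G).
  by apply: (@integrable_le_cst _ `|A * B * expR ((`|t| + 1) * B)|) => // x; rewrite normr_id.
have Gub s x : I s -> [set: U] x -> `|partial1of2 f s x| <= G x.
  move=> Is _; rewrite d1 normrN.
  exact: (le_trans (exp_mixture_le ghAB hB (It s Is) x)) (ler_norm _).
have derf s x : I s -> [set: U] x -> derivable (f ^~ x) s 1.
  by move=> _ _; apply: ex_derive.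
have G0 x : 0 <= G x by rewrite /G.
have := derivable_under_integral measurableT tI intf derf G0 intG Gub.
have := differentiation_under_integral measurableT tI intf derf G0 intG Gub.
rewrite derive1E => dE dF; apply: DeriveDef => //.
rewrite dE; under eq_Rintegral do rewrite d1 -mulN1r.
rewrite RintegralZl//; last first.
  exact: (integrable_le_cst (mghe t) (exp_mixture_le ghAB hB (It t tI))).
by rewrite mulN1r.
Qed.

End ExponentialMixture.

(** * Uniqueness of weighted bounded solutions of the Skellam system *)

Section Uniqueness.
Context {R : realType}.

(** The derivative is known at positive times only, as in the Skellam system; right continuity at 0
    supplies the missing endpoint, so [f] is nondecreasing on [[0, T]]. *)
Lemma ge0_of_derive_ge0 (f df : R -> R) (T : R) :
  (forall s : R, 0 < s -> is_derive s 1 f (df s)) -> f s @[s --> 0^'+] --> f 0 ->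
  (forall s : R, 0 < s -> 0 <= df s) -> f 0 = 0 -> 0 <= T -> 0 <= f T.
Proof.
move=> fD f0c df0 f0; rewrite le_eqVlt => /predU1P[<-|T0]; first by rewrite f0.
have oo (s : R) : s \in `]0, T[ -> 0 < s by rewrite in_itv/= => /andP[].
have fC (s : R) : 0 < s -> {for s, continuous f}.
  by move=> s0; apply/differentiable_continuous/derivable1_diffP; have [] := fD s s0.
have cf : {within `[0, T], continuous f}.
  apply/continuous_within_itvP => //; split => //.
    by move=> s /oo; exact: fC.
  exact/cvg_at_left_filter/fC.
have dv (s : R) : s \in `]0, T[ -> derivable f s 1 by move=> /oo /fD[].
have dge (s : R) : s \in `]0, T[ -> 0 <= derive1 f s.
  by move=> /oo s0; rewrite derive1E (@derive_val _ _ _ _ _ _ _ (fD s s0)) df0.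
rewrite -{1}f0; apply: (ger0_derive1_le_cc dv dge cf) => //.
- by rewrite in_itv/= lexx ltW.
- by rewrite in_itv/= lexx ltW.
- exact: ltW.
Qed.

(** Both [v + u] and [v - u] start at 0 and have nonnegative derivatives. *)
Lemma normr_le_of_derive_le (u v du dv : R -> R) (T : R) :
  (forall s : R, 0 < s -> is_derive s 1 u (du s)) ->
  (forall s : R, 0 < s -> is_derive s 1 v (dv s)) ->
  u s @[s --> 0^'+] --> u 0 -> v s @[s --> 0^'+] --> v 0 ->
  (forall s : R, 0 < s -> `|du s| <= dv s) ->
  u 0 = 0 -> v 0 = 0 -> 0 <= T -> `|u T| <= v T.
Proof.
move=> uD vD u0c v0c duv u0 v0 T0.
rewrite ler_norml -subr_ge0 opprK -[_ <= v T]subr_ge0; apply/andP; split.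
- apply: (@ge0_of_derive_ge0 (u \+ v) (du \+ dv)) => //.
  + by move=> s s0; apply: is_deriveD; [exact: uD|exact: vD].
  + exact: cvgD.
  + by move=> s /duv; rewrite ler_norml /= => /andP[]; lra.
  + by rewrite /= u0 v0 addr0.
- apply: (@ge0_of_derive_ge0 (v \- u) (dv \- du)) => //.
  + by move=> s s0; apply: is_deriveB; [exact: vD|exact: uD].
  + exact: cvgB.
  + by move=> s /duv; rewrite ler_norml /= => /andP[]; lra.
  + by rewrite /= u0 v0 subr0.
Qed.

(* The generator is bounded by K in the sup norm weighted by rho, so iterating
   the mean value inequality gives |u n t| <= C rho(n) (K t)^m / m! for all m. *)
Lemma skellam_ode_unique (a b C K : R) (rho : int -> R) (u : int -> R -> R) :
  0 <= a -> 0 <= b -> 0 <= C -> 0 <= K -> (forall n, 0 <= rho n) ->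
  (forall n, a * (rho (n - 1) + rho n) + b * (rho n + rho (n + 1)) <= K * rho n) ->
  (forall n (t : R), 0 <= t -> `|u n t| <= C * rho n) ->
  (forall n, u n 0 = 0) -> (forall n, u n s @[s --> 0^'+] --> u n 0) ->
  (forall n (t : R), 0 < t -> is_derive t 1 (u n)
     (a * (u (n - 1) t - u n t) - b * (u n t - u (n + 1) t))) ->
  forall n (t : R), 0 <= t -> u n t = 0.
Proof.
move=> a0 b0 C0 K0 rho0 rhoK ub u0 uc uD.
have bnd m : forall n t, 0 <= t ->
    `|u n t| <= C * rho n * K ^+ m / m`!%:R * t ^+ m.
  elim: m => [|m IH] n t t0.
    by rewrite !expr0 fact0 divr1 !mulr1 ub.
  have m0 : m`!%:R != 0 :> R by rewrite pnatr_eq0 -lt0n fact_gt0.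
  (* With this constant the derivative of [c * s ^+ m.+1] is the bound of order [m] with [rho n]
     replaced by [K * rho n], which is what [rhoK] yields from the bounds at [n - 1], [n] and
     [n + 1]. *)
  pose c := C * rho n * K ^+ m.+1 / m.+1`!%:R.
  have vD (s : R) : is_derive s 1 (fun s : R => c * s ^+ m.+1)
      (C * (K * rho n) * K ^+ m / m`!%:R * s ^+ m).
    have -> : C * (K * rho n) * K ^+ m / m`!%:R * s ^+ m =
        c *: ((m.+1%:R * s ^+ m) *: (1 : R)).
      rewrite /GRing.scale/= mulr1 /c factS natrM exprS.
      by field; rewrite m0 addrC natr1 pnatr_eq0.
    apply: (@is_deriveZ _ _ _ (fun s : R => s ^+ m.+1)).
    by apply: DeriveDef; [exact: exprn_derivable | rewrite exp_derive].
  apply: (normr_le_of_derive_le (uD n) (fun s _ => vD s)) => //.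
  - have /derivable1_diffP/differentiable_continuous :
        derivable (fun s : R => c * s ^+ m.+1) 0 1 by have [] := vD 0.
    exact: cvg_at_right_filter.
  - move=> s s0; have s0' := ltW s0.
    have e0 : 0 <= C * K ^+ m / m`!%:R * s ^+ m.
      by rewrite !mulr_ge0// ?exprn_ge0// invr_ge0 ler0n.
    have := IH n s s0'; have := IH (n - 1) s s0'; have := IH (n + 1) s s0'.
    set e := C * K ^+ m / m`!%:R * s ^+ m in e0.
    have E k : C * k * K ^+ m / m`!%:R * s ^+ m = e * k by rewrite /e; ring.
    rewrite !E => u1 u2 u3.
    apply: (le_trans (ler_normB _ _)); rewrite !normrM (ger0_norm a0) (ger0_norm b0).
    apply: (@le_trans _ _ (a * (e * rho (n - 1) + e * rho n)
                          + b * (e * rho n + e * rho (n + 1)))).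
      apply: lerD; apply: ler_wpM2l => //; apply: (le_trans (ler_normB _ _));
        exact: lerD.
    have := ler_wpM2l e0 (rhoK n); lra.
  - by rewrite expr0n mulr0.
move=> n t t0; apply/eqP; rewrite -normr_le0.
(* Up to the factor [C * rho n], the bound is the general term of the exponential series at [K * t],
   hence tends to 0. *)
have cv : C * rho n * exp_coeff (K * t) m @[m --> \oo] --> C * rho n * 0.
  by apply: cvgMr; exact: cvg_exp_coeff.
rewrite mulr0 in cv.
rewrite -(cvg_lim _ cv)//; apply: limr_ge; first by apply/cvg_ex; exists 0.
apply: nearW => m; apply: (le_trans (bnd m n t t0)).
by rewrite /exp_coeff/= exprMn; lra.
Qed.

End Uniqueness.

(** * Cosine coefficients and diagonalization of the generator *)

Section Fourier.
Context {R : realType}.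

(** The normalization absorbs the factor [1 / pi] and makes the bounds for probability measures
    applicable. Half of the circle suffices because the symbol is even. *)
Definition unif0pi : probability _ R := uniform_prob (pi_gt0 R).

Lemma measurable_cosM (n : int) :
  measurable_fun [set: R] (fun x => cos (n%:~R * x)).
Proof.
apply: continuous_measurable_fun => x.
apply: (@continuous_comp _ _ _ (fun x : R => n%:~R * x) cos).
  exact: mulrl_continuous.
exact: continuous_cos.
Qed.

Lemma sin_intM_pi (n : int) : sin (n%:~R * pi) = 0 :> R.
Proof.
have H k : sin (k%:R * pi) = 0 :> R.
  elim: k => [|k IH]; first by rewrite mul0r sin0.
  by rewrite -natr1 mulrDl mul1r sinDpi IH oppr0.
by case: n => k; rewrite ?NegzE ?mulrNz ?mulNr ?sinN H ?oppr0.
Qed.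

(** This orthogonality relation yields the initial condition of the Fourier representation. *)
Lemma Rintegral_unif0pi_cosM (n : int) :
  \int[unif0pi]_x cos (n%:~R * x) = (n == 0)%:R.
Proof.
have mc := measurable_cosM n.
have ic : unif0pi.-integrable [set: R] (EFin \o (fun x => cos (n%:~R * x))).
  apply: (@integrable_le_cst _ _ _ _ _ 1); first exact: mc.
  by move=> x; exact: cos_max.
have [->|n0] := eqVneq n 0.
  under eq_Rintegral do rewrite mul0r cos0.
  by rewrite Rintegral_cst// [X in fine X](probability_setT unif0pi) mulr1.
have n0' : n%:~R != 0 :> R by rewrite intr_eq0.
(* integral_uniform is only available for nonnegative functions, hence the + 1 *)
have E : (\int[unif0pi]_x (cos (n%:~R * x) + 1)%:E = 1%:E)%E.
  have mc1 : measurable_fun [set: R] (fun x => (cos (n%:~R * x) + 1)%:E).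
    by apply/measurable_EFinP/measurable_funD.
  have c1 x : (0 <= (cos (n%:~R * x) + 1)%:E :> \bar R)%E.
    by rewrite lee_fin; have := cos_geN1 (n%:~R * x); lra.
  rewrite integral_uniform//.
  (* The sine part of this primitive vanishes at both endpoints, so only the length [pi] remains and
     the density [1 / pi] cancels it. *)
  pose F (x : R) := sin (n%:~R * x) / n%:~R + x.
  have FD (x : R) : is_derive x 1 F (cos (n%:~R * x) + 1).
    rewrite /F; apply: is_derive_eq.
    by rewrite /GRing.scale/=; field.
  rewrite (@continuous_FTC2 _ _ F)//=; last 4 first.
  - exact: pi_gt0.
  - apply: continuous_subspaceT => x; apply: cvgD; last exact: cvg_cst.
    apply: (@continuous_comp _ _ _ (fun x : R => n%:~R * x) cos).
      exact: mulrl_continuous.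
    exact: continuous_cos.
  - have cF (x : R) : {for x, continuous F}.
      by apply/differentiable_continuous/derivable1_diffP; have [] := FD x.
    split.
    + by move=> x _; have [] := FD x.
    + exact/cvg_at_right_filter/cF.
    + exact/cvg_at_left_filter/cF.
  - by move=> x _; rewrite derive1E; apply: (@derive_val _ _ _ _ _ _ _ (FD x)).
  rewrite /F sin_intM_pi mulr0 sin0 !mul0r !add0r -EFinB -EFinM !subr0.
  by rewrite mulVf// gt_eqF// pi_gt0.
have : \int[unif0pi]_x (cos (n%:~R * x) + 1) = 1 by rewrite /Rintegral E.
rewrite RintegralD//; last first.
  by apply: (@integrable_le_cst _ _ _ _ _ 1) => // x; rewrite normr1.
rewrite Rintegral_cst// [X in fine X](probability_setT unif0pi) mulr1 /=.
lra.
Qed.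

Lemma normr_cosM_le (n : int) (g : R -> R) (C : R) :
  (forall x, `|g x| <= C) -> forall x, `|cos (n%:~R * x) * g x| <= C.
Proof.
by move=> gC x; rewrite normrM -[leRHS]mul1r; apply: ler_pM => //; exact: cos_max.
Qed.

Lemma integrable_cosM (n : int) (g : R -> R) (C : R) :
  measurable_fun [set: R] g -> (forall x, `|g x| <= C) ->
  unif0pi.-integrable [set: R] (EFin \o (fun x => cos (n%:~R * x) * g x)).
Proof.
move=> mg gC; apply: (@integrable_le_cst _ _ _ _ _ C).
  by apply: measurable_funM => //; exact: measurable_cosM.
exact: normr_cosM_le.
Qed.

Variables l m : R.
Hypotheses (l0 : 0 < l) (m0 : 0 < m).

(** This is the squared modulus of [l - m exp (i x)], hence it lies between [(l - m) ^+ 2] and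
    [(l + m) ^+ 2] for positive [l] and [m]. *)
Definition skellam_symbol (x : R) : R := l ^+ 2 + m ^+ 2 - 2 * l * m * cos x.

(** The weight [(l / m) ^ n] undoes the symmetrization of the generator. *)
Definition fourier_coef (n : int) (g : R -> R) : R :=
  (l / m) ^ n * \int[unif0pi]_x (cos (n%:~R * x) * g x).

Lemma skellam_symbol_ge0 x : 0 <= skellam_symbol x.
Proof.
rewrite /skellam_symbol.
have := ler_wpM2l (ltW (mulr_gt0 l0 m0)) (cos_le1 x).
by have := sqr_ge0 (l - m); nra.
Qed.

Lemma skellam_symbol_le x : skellam_symbol x <= (l + m) ^+ 2.
Proof.
rewrite /skellam_symbol.
by have := ler_wpM2l (ltW (mulr_gt0 l0 m0)) (cos_geN1 x); nra.
Qed.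

Lemma measurable_skellam_symbol : measurable_fun [set: R] skellam_symbol.
Proof.
have := measurable_cosM 1; under eq_fun do rewrite mul1r; move=> mc.
by apply: measurable_funB => //; apply: measurable_funM.
Qed.

(** Both [l ^+ 2 * (l / m) ^ (n - 1)] and [m ^+ 2 * (l / m) ^ (n + 1)] equal [l * m * (l / m) ^ n],
    and the sum of the cosines of [(n - 1) x] and [(n + 1) x] is [2 cos (n x) cos x]. The generator
    thus acts as multiplication by minus the symbol. *)
Lemma fourier_coef_generator (n : int) (g : R -> R) (C : R) :
  measurable_fun [set: R] g -> (forall x, `|g x| <= C) ->
  l ^+ 2 * (fourier_coef (n - 1) g - fourier_coef n g)
  - m ^+ 2 * (fourier_coef n g - fourier_coef (n + 1) g) =
  - fourier_coef n (fun x => skellam_symbol x * g x).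
Proof.
move=> mg gC.
have r0 : l / m != 0 by rewrite mulf_neq0 ?invr_eq0 ?gt_eqF.
pose f k x := cos (k%:~R * x) * g x.
have mf k : measurable_fun [set: R] (f k).
  by apply: measurable_funM => //; exact: measurable_cosM.
have fC k x : `|f k x| <= C by exact: normr_cosM_le.
have ig k : unif0pi.-integrable [set: R] (EFin \o f k) := integrable_cosM k mg gC.
have igD : unif0pi.-integrable [set: R] (EFin \o (fun x => f (n - 1) x + f (n + 1) x)).
  apply: (@integrable_le_cst _ _ _ _ _ (C + C)).
    exact: (measurable_funD (mf _) (mf _)).
  by move=> x; apply: (le_trans (ler_normD _ _)); exact: lerD.
have iZ a h : unif0pi.-integrable [set: R] (EFin \o h) ->
    unif0pi.-integrable [set: R] (EFin \o (fun x => a * h x)).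
  by move=> hi; exact: (integrableZl measurableT a hi).
have -> : fourier_coef n (fun x => skellam_symbol x * g x) =
    (l / m) ^ n * ((l ^+ 2 + m ^+ 2) * \int[unif0pi]_x f n x
     - l * m * (\int[unif0pi]_x f (n - 1) x + \int[unif0pi]_x f (n + 1) x)).
  congr (_ * _).
  rewrite -RintegralD// -!RintegralZl// -RintegralB; [|by []|exact: iZ|exact: iZ].
  apply: eq_Rintegral => x _; rewrite /skellam_symbol /f.
  have -> : (n - 1)%:~R * x = n%:~R * x - x by rewrite intrB mulr1z; ring.
  have -> : (n + 1)%:~R * x = n%:~R * x + x by rewrite intrD mulr1z; ring.
  rewrite cosB cosD; ring.
rewrite /fourier_coef /f !expfzDr// expr1z exprN1; field.
by rewrite !gt_eqF.
Qed.

(** Each differentiation brings down a factor [- h]. The prefactor [g] allows iteration: [g = 1]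
    gives the first derivative and [g = h] the second. *)
Lemma is_derive_fourier_coef (n : int) (g h : R -> R) (A B t : R) :
  measurable_fun [set: R] g -> measurable_fun [set: R] h ->
  (forall x, `|g x| <= A) -> (forall x, 0 <= h x <= B) ->
  is_derive t 1 (fun s => fourier_coef n (fun x => g x * expR (- (s * h x))))
    (- fourier_coef n (fun x => h x * g x * expR (- (t * h x)))).
Proof.
move=> mg mh gA hB.
have D : is_derive t 1
    (fun s => \int[unif0pi]_x (cos (n%:~R * x) * g x * expR (- (s * h x))))
    (- \int[unif0pi]_x (cos (n%:~R * x) * g x * h x * expR (- (t * h x)))).
  apply: (@is_derive_exp_mixture _ _ _ _ _ _ A B) => //.
  - by apply: measurable_funM => //; exact: measurable_cosM.
  - exact: normr_cosM_le.
have -> : (fun s => fourier_coef n (fun x => g x * expR (- (s * h x)))) =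
    (l / m) ^ n \*: (fun s => \int[unif0pi]_x (cos (n%:~R * x) * g x * expR (- (s * h x)))).
  apply/funext => s; congr (_ * _).
  by apply: eq_Rintegral => x _; rewrite mulrA.
have -> : - fourier_coef n (fun x => h x * g x * expR (- (t * h x))) =
    (l / m) ^ n *: - \int[unif0pi]_x (cos (n%:~R * x) * g x * h x * expR (- (t * h x))).
  rewrite scalerN; congr (- (_ * _)).
  by apply: eq_Rintegral => x _; ring.
exact: is_deriveZ.
Qed.

Lemma normr_fourier_coef_le (n : int) (g : R -> R) (C : R) :
  measurable_fun [set: R] g -> (forall x, `|g x| <= C) ->
  `|fourier_coef n g| <= (l / m) ^ n * C.
Proof.
move=> mg gC.
have r0 : 0 <= (l / m) ^ n by rewrite exprz_ge0// divr_ge0// ltW.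
rewrite /fourier_coef normrM ger0_norm//; apply: ler_wpM2l => //.
apply: normr_Rintegral_le_cst.
  by apply: measurable_funM => //; exact: measurable_cosM.
exact: normr_cosM_le.
Qed.

Lemma fourier_coefZ (n : int) (a : R) (g : R -> R) (C : R) :
  measurable_fun [set: R] g -> (forall x, `|g x| <= C) ->
  fourier_coef n (fun x => a * g x) = a * fourier_coef n g.
Proof.
move=> mg gC; rewrite /fourier_coef mulrCA; congr (_ * _).
rewrite -RintegralZl//; first by apply: eq_Rintegral => x _; rewrite mulrCA.
exact: integrable_cosM gC.
Qed.

Lemma fourier_coefD (n : int) (g1 g2 : R -> R) (C1 C2 : R) :
  measurable_fun [set: R] g1 -> (forall x, `|g1 x| <= C1) ->
  measurable_fun [set: R] g2 -> (forall x, `|g2 x| <= C2) ->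
  fourier_coef n (fun x => g1 x + g2 x) = fourier_coef n g1 + fourier_coef n g2.
Proof.
move=> mg1 gC1 mg2 gC2; rewrite /fourier_coef -mulrDr; congr (_ * _).
rewrite -RintegralD; [|by []|exact: integrable_cosM gC1|exact: integrable_cosM gC2].
by apply: eq_Rintegral => x _; rewrite mulrDr.
Qed.

Lemma fourier_coef1 (n : int) : fourier_coef n (cst 1) = (n == 0)%:R.
Proof.
rewrite /fourier_coef /=; under eq_Rintegral do rewrite mulr1.
by rewrite Rintegral_unif0pi_cosM; case: eqP => [->|]; rewrite ?mulr0 ?expr0z ?mulr1.
Qed.

End Fourier.

(** * Right-continuous integer-valued processes: limits of state events *)

Section RandomTime.
Context {R : realType} {d : measure_display} {T : measurableType d}.
Variable P : probability T R.

(** The indicators converge pointwise, being eventually constant at each [w]; this gives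
    measurability of the limit event, and dominated convergence gives the limit of the
    probabilities. *)
Lemma cvg_probability (E : nat -> set T) (F : set T) :
  (forall k, measurable (E k)) ->
  (forall w, \forall k \near \oo, E k w <-> F w) ->
  measurable F /\ P (E k) @[k --> \oo] --> P F.
Proof.
move=> mE EF.
have EFE w : (\1_(E k) w : R) @[k --> \oo] --> (\1_F w : R).
  apply: cvg_near_cst; have := EF w; apply: filterS => k EFk.
  rewrite !indicE; congr (_%:R); congr nat_of_bool.
  by apply/idP/idP; rewrite !inE => /EFk.
have mF : measurable F.
  apply/(@measurable_indicP _ _ R); apply: (measurable_fun_cvg (h := fun k => \1_(E k))).
    by move=> k; apply: measurable_indic.
  by move=> w _; exact: EFE.
split => //.
have [] := @dominated_convergence _ _ _ P _ measurableT
  (fun k w => (\1_(E k) w)%:E) (fun w => (\1_F w)%:E) (cst 1%:E).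
- by move=> k; apply/measurable_EFinP; apply: measurable_indic.
- by apply/measurable_EFinP; apply: measurable_indic.
- apply: aeW => w _; apply: cvg_EFin; first exact: nearW.
  exact: EFE.
- by apply: (@integrable_le_cst _ _ _ _ _ 1) => // x; rewrite normr1.
- apply: aeW => w k _; rewrite /= lee_fin indicE.
  by case: (_ \in _); rewrite /= ?normr1 ?normr0.
move=> _ _; rewrite /= integral_indic// setIT.
by under eq_fun do rewrite integral_indic// setIT.
Qed.

Variable S : R -> T -> R.
Hypotheses (mS : measurable_process S) (rS : right_continuous S)
  (iS : integer_valued S).

(** By right continuity [S (u k) w] is eventually at distance less than 1 from [S t w], and two such
    integers are equal. *)
Lemma near_integer_valued (n : int) (t : R) (u : nat -> R) (w : T) :
  0 <= t -> (forall k, t < u k) -> u k @[k --> \oo] --> t ->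
  \forall k \near \oo, S (u k) w = n%:~R <-> S t w = n%:~R.
Proof.
move=> t0 tu ut; have [a Sa] := @iS t w t0.
have /cvg_at_rightP/(_ u (conj tu ut)) /cvgrPdist_lt /(_ 1 ltr01) := @rS w t t0.
apply: filterS => k; have [b ->] := @iS (u k) w (le_trans t0 (ltW (tu k))).
rewrite Sa -intrB -intr_norm -[1]/(1%:~R) ltr_int => ab.
have -> : a = b by lia.
by [].
Qed.

Lemma measurable_state (n : int) (t : R) :
  0 <= t -> measurable [set w | S t w = n%:~R].
Proof.
move=> t0; have := mS t0 measurableT (@measurable_set1 _ (n%:~R : R)).
by rewrite setTI.
Qed.

(** At [t = 0] this is the continuity that the uniqueness argument requires. *)
Lemma state_prob_cvg_right (n : int) (t : R) : 0 <= t ->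
  state_prob P S n s @[s --> t^'+] --> state_prob P S n t.
Proof.
move=> t0; apply/cvg_at_rightP => u [tu ut].
have mE k : measurable [set w | S (u k) w = n%:~R].
  by apply: measurable_state; exact: le_trans t0 (ltW (tu k)).
have [mF] := cvg_probability mE (fun w => near_integer_valued n w t0 tu ut).
by rewrite -(fineK (fin_num_measure P _ mF)) => /fine_cvg.
Qed.


(* Strictly above x, so that right-continuity applies along grid_above k x. *)
Definition grid_above (k : nat) (x : R) : R :=
  (Num.truncn (k.+1%:R * x)).+1%:R / k.+1%:R.

Lemma grid_above_gt k x : x < grid_above k x.
Proof.
by rewrite /grid_above ltr_pdivlMr ?ltr0n// mulrC; exact: truncnS_gt.
Qed.

Lemma cvg_grid_above x : 0 <= x -> grid_above k x @[k --> \oo] --> x.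
Proof.
move=> x0; apply: (@squeeze_cvgr _ _ _ _ (cst x) (fun k => x + harmonic k)).
- apply: nearW => k; rewrite (ltW (grid_above_gt _ _))/=.
  have /truncn_itv/andP[h _] : 0 <= k.+1%:R * x by rewrite mulr_ge0.
  rewrite /grid_above /harmonic /= -[X in X / _]natr1 mulrDl mul1r lerD2r.
  by rewrite ler_pdivrMr ?ltr0n// (mulrC x).
- exact: cvg_cst.
- by rewrite -[X in _ --> X]addr0; apply: cvgD; [exact: cvg_cst|exact: cvg_harmonic].
Qed.

(** * State probabilities at an independent random time *)

Variables (Z : T -> R) (n : int) (q : R -> R).
Hypotheses (mZ : measurable_fun [set: T] Z) (Z0 : forall w, 0 <= Z w).
Hypothesis indep : forall (t : R) (B : set R), 0 <= t -> measurable B ->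
  P ([set w | S t w = n%:~R] `&` Z @^-1` B) =
  (P [set w | S t w = n%:~R] * P (Z @^-1` B))%E.
Hypotheses (cq : continuous q)
  (qE : forall t, 0 <= t -> q t = state_prob P S n t).

Let q_ge0 t : 0 <= t -> 0 <= q t.
Proof. by move=> t0; rewrite qE// fine_ge0. Qed.

Let q_le1 t : 0 <= t -> q t <= 1.
Proof.
move=> t0; rewrite qE// /state_prob -lee_fin fineK ?fin_num_measure//.
  by apply: probability_le1; apply: measurable_state.
exact: measurable_state.
Qed.

(** The discretized time takes countably many values. On each cell of [Z] it is deterministic, so
    independence factors the probability; countable additivity sums over the cells. *)
Lemma probability_at_discretized_time k :
  let E := [set w | S (grid_above k (Z w)) w = n%:~R] in
  [/\ measurable E,
      measurable_fun [set: T] (fun w => q (grid_above k (Z w))) &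
      P E = (\int[P]_w (q (grid_above k (Z w)))%:E)%E].
Proof.
pose t (j : nat) : R := j.+1%:R / k.+1%:R.
have t0 j : 0 <= t j by rewrite divr_ge0.
(* On this cell, closed on the left, the truncation of [k.+1%:R * Z w] is [j], so the grid value is
   the right endpoint [t j]. *)
pose B (j : nat) : set R := [set` `[j%:R / k.+1%:R, j.+1%:R / k.+1%:R[].
have ZB j w : (Z @^-1` B j) w -> grid_above k (Z w) = t j.
  rewrite /B/= in_itv/= ler_pdivrMr ?ltr0n// ltr_pdivlMr ?ltr0n// => jZ.
  by rewrite /grid_above (mulrC k.+1%:R) (@truncn_def _ _ j).
have mZB j : measurable (Z @^-1` B j).
  by rewrite -[_ @^-1` _]setTI; apply: mZ => //; exact: measurable_itv.
(* Distinct cells have distinct grid values, which makes them disjoint. *)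
have tZB : trivIset setT (fun j => Z @^-1` B j).
  apply/trivIsetP => i j _ _ ij; apply/seteqP; split=> // w [/ZB wi /ZB].
  rewrite wi /t => /(congr1 ( *%R^~ k.+1%:R)); rewrite !divfK ?pnatr_eq0//.
  by move/eqP; rewrite eqr_nat eqSS (negbTE ij).
have UZB : \bigcup_j (Z @^-1` B j) = [set: T].
  apply/seteqP; split=> // w _; exists (Num.truncn (k.+1%:R * Z w)) => //=.
  rewrite /B/= in_itv/= ler_pdivrMr ?ltr0n// ltr_pdivlMr ?ltr0n// (mulrC (Z w)).
  by apply: truncn_itv; rewrite mulr_ge0.
move=> E.
have EE : E = \bigcup_j ([set w | S (t j) w = n%:~R] `&` Z @^-1` B j).
  rewrite -[E]setIT -UZB setI_bigcupr; apply: eq_bigcup => // j _.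
  apply/seteqP; split=> w [Ew /[dup] wB /ZB wt]; split => //.
    by move: Ew; rewrite /E/= wt.
  by move: Ew; rewrite /E/= wt.
have mSB j : measurable ([set w | S (t j) w = n%:~R] `&` Z @^-1` B j).
  by apply: measurableI => //; exact: measurable_state.
have mq : measurable_fun [set: T] (fun w => q (grid_above k (Z w))).
  rewrite -UZB; apply/measurable_fun_bigcup => // j.
  apply: (@eq_measurable_fun _ _ _ _ _ (cst (q (t j)))) => //.
  by move=> w; rewrite inE => /ZB ->.
split => //; first by rewrite EE; exact: bigcup_measurable.
rewrite EE measure_bigcup//; last exact: trivIset_setIl.
rewrite -UZB ge0_integral_bigcup//; last 2 first.
  by rewrite UZB; apply/measurable_EFinP.
  move=> w _; rewrite lee_fin q_ge0//.
  exact: le_trans (Z0 w) (ltW (grid_above_gt _ _)).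
rewrite (eq_eseriesl (Q := xpredT)); last by move=> j; exact: in_setT.
apply: eq_eseriesr => j _.
rewrite [LHS](indep (t0 j)); last exact: measurable_itv.
under eq_integral => w do rewrite inE => /ZB ->.
rewrite integral_cst//; congr (_ * _)%E.
by rewrite qE// /state_prob fineK// fin_num_measure//; exact: measurable_state.
Qed.

(** The grid times decrease to [Z] in the limit from strictly above. The discretized identity passes
    to the limit on the left by right continuity of [S], and on the right by continuity of [q] and
    domination by 1. *)
Lemma probability_at_random_time :
  P [set w | S (Z w) w = n%:~R] = (\int[P]_w (q (Z w))%:E)%E.
Proof.
pose E k := [set w | S (grid_above k (Z w)) w = n%:~R].
have mE k : measurable (E k) by have [] := probability_at_discretized_time k.
have EF w : \forall k \near \oo, E k w <-> S (Z w) w = n%:~R.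
  apply: near_integer_valued => //; first by move=> k; exact: grid_above_gt.
  exact: cvg_grid_above.
have [_ cE] := cvg_probability mE EF.
(* It remains to show that the same probabilities also converge to the integral of [q (Z w)]. *)
apply: (cvg_unique _ cE) => //.
have [] := @dominated_convergence _ _ _ P _ measurableT
  (fun k w => (q (grid_above k (Z w)))%:E) (fun w => (q (Z w))%:E) (cst 1%:E).
- by move=> k; apply/measurable_EFinP; have [] := probability_at_discretized_time k.
- apply/measurable_EFinP; apply: measurableT_comp => //.
  exact: continuous_measurable_fun.
- apply: aeW => w _; apply: cvg_EFin; first exact: nearW.
  exact: (cvg_comp _ _ (cvg_grid_above (Z0 w)) (@cq (Z w))).
- by apply: (@integrable_le_cst _ _ _ _ _ 1) => // x; rewrite normr1.
- apply: aeW => w k _; rewrite /= lee_fin.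
  have D0 : 0 <= grid_above k (Z w) := le_trans (Z0 w) (ltW (grid_above_gt _ _)).
  by rewrite ger0_norm ?q_le1// q_ge0.
move=> _ _; apply: cvg_trans; apply: near_eq_cvg; apply: nearW => k /=.
by have [_ _ <-] := probability_at_discretized_time k.
Qed.

End RandomTime.

(** * The Laplace exponent of the inverse Gaussian subordinator *)

Section InverseGaussianExponent.
Context {R : realType}.
Variables delta gamma : R.
Hypotheses (delta0 : 0 < delta) (gamma0 : 0 < gamma).

Lemma ig_exponent_le (s t : R) :
  s <= t -> ig_exponent delta gamma s <= ig_exponent delta gamma t.
Proof.
move=> st; rewrite /ig_exponent; apply: ler_wpM2l; first exact: ltW.
by rewrite lerD2r ler_wsqrtr// lerD2r ler_wpM2l.
Qed.

Lemma ig_exponent0 : ig_exponent delta gamma 0 = 0.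
Proof.
by rewrite /ig_exponent mulr0 add0r sqrtr_sqr gtr0_norm// subrr mulr0.
Qed.

Lemma ig_exponent_ge0 (s : R) : 0 <= s -> 0 <= ig_exponent delta gamma s.
Proof. by move=> /ig_exponent_le; rewrite ig_exponent0. Qed.

(** With [r] the square root, the exponent is [delta * (r - gamma)], and adding [2 * delta * gamma]
    to it gives [delta * (r + gamma)]; their product is [delta ^+ 2 * (r ^+ 2 - gamma ^+ 2)]. *)
Lemma ig_exponent_quadratic (s : R) : 0 <= s ->
  ig_exponent delta gamma s ^+ 2 + 2 * delta * gamma * ig_exponent delta gamma s
  = 2 * delta ^+ 2 * s.
Proof.
move=> s0; rewrite /ig_exponent.
have := @sqr_sqrtr _ (2 * s + gamma ^+ 2); set r := Num.sqrt _ => rE.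
have {}rE : r ^+ 2 = 2 * s + gamma ^+ 2.
  by rewrite rE// addr_ge0 ?sqr_ge0// mulr_ge0.
transitivity (delta ^+ 2 * (r ^+ 2 - gamma ^+ 2)); first by ring.
by rewrite rE; ring.
Qed.

Lemma measurable_ig_exponent (c : R -> R) : measurable_fun [set: R] c ->
  measurable_fun [set: R] (fun x => ig_exponent delta gamma (c x)).
Proof.
move=> mc; apply: measurable_funM => //; apply: measurable_funB => //.
apply: measurableT_comp.
  exact: continuous_measurable_fun (@sqrt_continuous R).
by apply: measurable_funD => //; apply: measurable_funM.
Qed.

End InverseGaussianExponent.

(** * Fourier representation of the subordinated process and its equation *)

Section Subordination.
Context {R : realType} {d : measure_display} {T : measurableType d}.
Variables (P : probability T R) (Lam Lambar delta gamma : R) (S Y : R -> T -> R).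
Hypotheses (Lam0 : 0 < Lam) (Lambar0 : 0 < Lambar).
Hypotheses (mS : measurable_process S) (rS : right_continuous S)
  (iS : integer_valued S)
  (sysS : skellam_system Lam Lambar (state_prob P S)).
Hypotheses (delta0 : 0 < delta) (gamma0 : 0 < gamma)
  (hY : inverse_gaussian_subordinator P delta gamma Y).

Let l : R := Num.sqrt Lam.
Let m : R := Num.sqrt Lambar.
Let l0 : 0 < l. Proof. by rewrite sqrtr_gt0. Qed.
Let m0 : 0 < m. Proof. by rewrite sqrtr_gt0. Qed.
Let lE : l ^+ 2 = Lam. Proof. by rewrite sqr_sqrtr// ltW. Qed.
Let mE : m ^+ 2 = Lambar. Proof. by rewrite sqr_sqrtr// ltW. Qed.
Let c := skellam_symbol l m.

Let mc : measurable_fun [set: R] c.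
Proof. exact: measurable_skellam_symbol. Qed.

Let c0 x : 0 <= c x.
Proof. exact: skellam_symbol_ge0. Qed.

Let c_bound x : 0 <= c x <= (l + m) ^+ 2.
Proof. by rewrite c0 skellam_symbol_le. Qed.

Let q (n : int) (t : R) := fourier_coef l m n (fun x => expR (- (t * c x))).

Let measurable_expN (h : R -> R) (t : R) : measurable_fun [set: R] h ->
  measurable_fun [set: R] (fun x => expR (- (t * h x))).
Proof.
by move=> mh; do 2 apply: measurableT_comp => //; apply: measurable_funM.
Qed.

Let expN_le1 (h : R -> R) (t : R) : (forall x, 0 <= h x) -> 0 <= t ->
  forall x, `|expR (- (t * h x))| <= 1.
Proof.
move=> h0 t0 x; rewrite ger0_norm ?expR_ge0// -expR0 ler_expR oppr_le0.
exact: mulr_ge0.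
Qed.

(** Boundedness of the symbol makes this valid at every real [t]; in particular [q n] is continuous
    on the whole line, including at 0. *)
Let is_derive_q n (t : R) : is_derive t 1 (q n)
  (Lam * (q (n - 1) t - q n t) - Lambar * (q n t - q (n + 1) t)).
Proof.
rewrite -lE -mE /q.
have g1 (x : R) : `|(1 : R)| <= 1 by rewrite normr1.
have B x : `|expR (- (t * c x))| <= 1 * expR (`|t| * (l + m) ^+ 2).
  by rewrite -[X in `|X|]mul1r; exact: (exp_mixture_le g1 c_bound (lexx `|t|)).
rewrite (fourier_coef_generator l0 m0 n (measurable_expN t mc) B).
have := @is_derive_fourier_coef _ l m n _ c 1 _ t (measurable_cst (1 : R)) mc g1 c_bound.
rewrite /cst.
have E1 s : (fun x => 1 * expR (- (s * c x))) = (fun x => expR (- (s * c x))).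
  by apply/funext => x; rewrite mul1r.
have E2 : (fun x => c x * 1 * expR (- (t * c x))) = (fun x => c x * expR (- (t * c x))).
  by apply/funext => x; rewrite mulr1.
by rewrite E2; under [X in is_derive _ _ X _ -> _]eq_fun do rewrite E1.
Qed.

Lemma state_prob_fourier n (t : R) : 0 <= t ->
  state_prob P S n t = fourier_coef l m n (fun x => expR (- (t * c x))).
Proof.
case: sysS => p00 p0 pD.
have r0 (k : int) : 0 <= (l / m) ^ k by rewrite exprz_ge0// divr_ge0// ltW.
have rN0 : l / m != 0 by rewrite mulf_neq0 ?invr_eq0 ?gt_eqF.
move=> t0; apply/eqP; rewrite -subr_eq0; apply/eqP.
(* In the weight, 1 bounds the probabilities and [(l / m) ^ k] bounds [q k]. Taking absolute values
   in the generator multiplies the first term by [2 * (Lam + Lambar)] and the second by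
   [(l + m) ^+ 2], which is no larger. *)
apply: (@skellam_ode_unique _ Lam Lambar 1 (2 * (Lam + Lambar))
  (fun k => 1 + (l / m) ^ k) (fun k t => state_prob P S k t - q k t)
  (ltW Lam0) (ltW Lambar0) ler01 _ _ _ _ _ _ _ n t t0).
- by rewrite mulr_ge0// addr_ge0// ltW.
- by move=> k; rewrite addr_ge0.
- move=> k; rewrite !expfzDr// expr1z exprN1 -lE -mE.
  set r := (l / m) ^ k.
  have -> : l ^+ 2 * (1 + r * (l / m)^-1 + (1 + r)) + m ^+ 2 * (1 + r + (1 + r * (l / m)))
     = 2 * (l ^+ 2 + m ^+ 2) + r * (l ^+ 2 + m ^+ 2 + 2 * l * m).
    by field; rewrite !gt_eqF.
  have := ler_wpM2l (r0 k) (sqr_ge0 (l - m)); rewrite -/r; lra.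
- move=> k s s0; rewrite mul1r; apply: (le_trans (ler_normB _ _)); apply: lerD.
    rewrite ger0_norm ?fine_ge0// /state_prob -lee_fin fineK.
      by apply: probability_le1; exact: measurable_state.
    by apply: fin_num_measure; exact: measurable_state.
  rewrite -[leRHS]mulr1; apply: normr_fourier_coef_le => //.
    exact: measurable_expN.
  exact: expN_le1.
- move=> k; have -> : q k 0 = (k == 0)%:R.
    rewrite -(fourier_coef1 l m); congr fourier_coef.
    by apply/funext => x; rewrite mul0r oppr0 expR0.
  by have [->|/p0 ->] := eqVneq k 0; rewrite ?p00 subrr.
- move=> k; apply: cvgB; first exact: state_prob_cvg_right.
  apply: cvg_at_right_filter.
  by apply/differentiable_continuous/derivable1_diffP; have [] := is_derive_q k 0.
- move=> k s s0; apply: (is_derive_eq (is_deriveB (pD k s s0) (is_derive_q k s))).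
  ring.
Qed.


Hypothesis indepSY : independent_processes P S Y.

Let Y_ge0 (t : R) w : 0 <= t -> 0 <= Y t w.
Proof.
move=> t0; case: hY => -[[_ Y00 _ _ _] Ymono] _.
by rewrite -(Y00 w); exact: Ymono.
Qed.

Let measurable_Y (t : R) : 0 <= t -> measurable_fun [set: T] (Y t).
Proof. by case: hY => -[[mY _ _ _ _] _] _; exact: mY. Qed.

(** The transform is prescribed for [s > 0]. The value at 0 is added because the symbol vanishes at
    [x = 0] when [l = m]. *)
Let laplace (s t : R) : 0 <= s -> 0 <= t ->
  (\int[P]_w (expR (- (Y t w * s)))%:E =
   (expR (- (t * ig_exponent delta gamma s)))%:E)%E.
Proof.
move=> + t0; rewrite le_eqVlt => /predU1P[<-|s0].
  under eq_integral do rewrite mulr0 oppr0 expR0.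
  rewrite integral_cst// mul1e [LHS](probability_setT P).
  by rewrite ig_exponent0// mulr0 oppr0 expR0.
case: hY => _ /(_ s t s0 t0); rewrite expectation.unlock mulNr => <-.
by apply: eq_integral => w _; rewrite mulNr mulrC.
Qed.

(** Conditioning on [Y t] averages [q n] over the law of [Y t]; exchanging this average with the
    Fourier integral leaves the Laplace transform of [Y t] at the symbol. *)
Lemma subordinated_state_prob n (t : R) : 0 <= t ->
  state_prob P (subordinated S Y) n t =
  fourier_coef l m n (fun x => expR (- (t * ig_exponent delta gamma (c x)))).
Proof.
move=> t0; rewrite /state_prob /subordinated.
have indep (s : R) (B : set R) : 0 <= s -> measurable B ->
    P ([set w | S s w = n%:~R] `&` Y t @^-1` B) =
    (P [set w | S s w = n%:~R] * P (Y t @^-1` B))%E.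
  move=> s0 mB; apply: indepSY; apply: sub_sigma_algebra.
    by exists s, [set n%:~R]; split => //; exact: measurable_set1.
  by exists t, B.
have cq : continuous (q n).
  move=> s; apply/differentiable_continuous/derivable1_diffP.
  by have [] := is_derive_q n s.
rewrite (probability_at_random_time mS rS iS (measurable_Y t0)
  (fun w => Y_ge0 w t0) indep cq (fun s s0 => esym (state_prob_fourier n s0))).
have r0 : 0 <= (l / m) ^ n by rewrite exprz_ge0// divr_ge0// ltW.
(* The joint integrand is bounded by [(l / m) ^ n], hence integrable for the product of the two
   probabilities, as Fubini's theorem requires. *)
pose F (z : T * R) : R := (l / m) ^ n * (cos (n%:~R * z.2) * expR (- (Y t z.1 * c z.2))).
have expC w x : `|cos (n%:~R * x) * expR (- (Y t w * c x))| <= 1.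
  rewrite normrM -[leRHS]mul1r; apply: ler_pM => //; first exact: cos_max.
  by apply: expN_le1 => //; exact: Y_ge0.
have FC z : `|F z| <= (l / m) ^ n.
  by rewrite normrM (ger0_norm r0) -[leRHS]mulr1 ler_wpM2l.
have mF : measurable_fun [set: T * R] F.
  apply: measurable_funM => //; apply: measurable_funM.
    exact: (measurableT_comp (measurable_cosM n) measurable_snd).
  do 2 apply: measurableT_comp => //; apply: measurable_funM.
    exact: (measurableT_comp (measurable_Y t0) measurable_fst).
  exact: (measurableT_comp mc measurable_snd).
have iF : (P \x unif0pi)%E.-integrable [set: T * R] (EFin \o F).
  exact: (@integrable_le_cst _ _ _ (P \x unif0pi)%E _ _ mF FC).
transitivity (fine (\int[P]_w \int[unif0pi]_x (F (w, x))%:E)%E).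
  congr fine; apply: eq_integral => w _.
  have ie := integrable_cosM n (measurable_expN (Y t w) mc)
    (expN_le1 c0 (Y_ge0 w t0)).
  rewrite /q /fourier_coef -RintegralZl// /Rintegral fineK//.
  exact/integrable_fin_num/(integrableZl measurableT _ ie).
rewrite (Fubini iF).
have h0 x : 0 <= ig_exponent delta gamma (c x) by exact: ig_exponent_ge0.
transitivity (fine (\int[unif0pi]_x ((l / m) ^ n *
   (cos (n%:~R * x) * expR (- (t * ig_exponent delta gamma (c x)))))%:E)%E).
  congr fine; apply: eq_integral => x _; rewrite /F/=.
  under eq_integral do rewrite mulrA EFinM.
  rewrite integralZl//; first by rewrite laplace// -EFinM -mulrA.
  have me : measurable_fun [set: T] (fun w => expR (- (Y t w * c x))).
    do 2 apply: measurableT_comp => //; apply: measurable_funM => //.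
    exact: measurable_Y.
  apply: (integrable_le_cst P me (C := 1)) => w.
  exact: (expN_le1 (h := fun=> c x) (fun=> c0 x) (Y_ge0 w t0) x).
rewrite /fourier_coef -RintegralZl//.
apply: (@integrable_cosM _ _ _ 1); last exact: expN_le1.
by apply: measurable_expN; exact: measurable_ig_exponent.
Qed.


(** Two differentiations turn the left side into the coefficient of
    [(h ^+ 2 + 2 * delta * gamma * h) * e t], and the generator turns the right side into that of
    [2 * delta ^+ 2 * c * e t]. The quadratic identity equates them pointwise. *)
Lemma subordinated_ode n (t : R) : 0 < t ->
  let p := state_prob P (subordinated S Y) in
  [/\ derivable (p n) t 1, derivable (derive1 (p n)) t 1 &
    derive1n 2 (p n) t - 2 * delta * gamma * derive1 (p n) t =
    - 2 * delta ^+ 2 *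
      (Lam * (p (n - 1) t - p n t) - Lambar * (p n t - p (n + 1) t))].
Proof.
move=> t0 p; pose h (x : R) := ig_exponent delta gamma (c x).
pose e (s x : R) := expR (- (s * h x)).
(* Monotonicity of the exponent carries the upper bound of the symbol to [h]. *)
pose H := ig_exponent delta gamma ((l + m) ^+ 2).
have h0 x : 0 <= h x by exact: ig_exponent_ge0.
have h_bound x : 0 <= h x <= H.
  by rewrite h0 ig_exponent_le//; have /andP[] := c_bound x.
have mh : measurable_fun [set: R] h by exact: measurable_ig_exponent.
have hH x : `|h x| <= H by rewrite ger0_norm//; have /andP[] := h_bound x.
have D1 (s : R) : is_derive s 1 (fun s => fourier_coef l m n (e s))
    (- fourier_coef l m n (fun x => h x * e s x)).
  have g1 (x : R) : `|(1 : R)| <= 1 by rewrite normr1.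
  have := @is_derive_fourier_coef _ l m n _ h 1 _ s (measurable_cst (1 : R)) mh g1 h_bound.
  rewrite /cst.
  have -> : (fun x => h x * 1 * expR (- (s * h x))) = (fun x => h x * e s x).
    by apply/funext => x; rewrite mulr1.
  have E1 s' : (fun x => 1 * expR (- (s' * h x))) = e s'.
    by apply/funext => x; rewrite mul1r.
  by under [X in is_derive _ _ X _ -> _]eq_fun do rewrite E1.
have D2 (s : R) : is_derive s 1 (fun s => - fourier_coef l m n (fun x => h x * e s x))
    (fourier_coef l m n (fun x => h x * h x * e s x)).
  rewrite -[fourier_coef l m n (fun x => h x * h x * e s x)]opprK.
  apply: is_deriveN; exact: (@is_derive_fourier_coef _ l m n h h H H s mh mh hH h_bound).
have nt0 (s : R) : 0 < s -> \forall u \near s, (0 : R) < u by exact: lt_nbhsr.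
(* The Fourier formula for [p n] is available at nonnegative times only, so derivatives are
   transferred on a neighbourhood of a positive time. *)
have pE (s : R) : 0 < s -> is_derive s 1 (p n) (- fourier_coef l m n (fun x => h x * e s x)).
  move=> s0; apply: near_eq_is_derive (D1 s); near=> u.
  by rewrite /p subordinated_state_prob// ltW//; near: u; exact: nt0.
have p1E (s : R) : 0 < s -> derive1 (p n) s = - fourier_coef l m n (fun x => h x * e s x).
  by move=> /pE D; rewrite derive1E derive_val.
have p1D : is_derive t 1 (derive1 (p n)) (fourier_coef l m n (fun x => h x * h x * e t x)).
  apply: near_eq_is_derive (D2 t); near=> u.
  by rewrite p1E//; near: u; exact: nt0.
split; [by have [] := pE t t0|by have [] := p1D|].
rewrite derive1nS derive1n1.
rewrite [derive1 (derive1 _) t]derive1E (@derive_val _ _ _ _ _ _ _ p1D) p1E//.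
rewrite /p !subordinated_state_prob ?ltW//.
rewrite -lE -mE.
have me : measurable_fun [set: R] (e t) by exact: measurable_expN.
have e1 x : `|e t x| <= 1 := expN_le1 h0 (ltW t0) x.
rewrite (fourier_coef_generator l0 m0 n me e1).
have mhe : measurable_fun [set: R] (fun x => h x * e t x) by apply: measurable_funM.
have heH x : `|h x * e t x| <= H.
  by rewrite normrM -[leRHS]mulr1; apply: ler_pM.
have mce : measurable_fun [set: R] (fun x => c x * e t x) by apply: measurable_funM.
have mhhe : measurable_fun [set: R] (fun x => h x * h x * e t x).
  by apply: measurable_funM => //; apply: measurable_funM.
have hheH x : `|h x * h x * e t x| <= H * H.
  by rewrite -mulrA normrM; apply: ler_pM.
have ceC x : `|c x * e t x| <= (l + m) ^+ 2.
  have /andP[cx0 cxC] := c_bound x.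
  by rewrite normrM -[leRHS]mulr1; apply: ler_pM => //; rewrite ger0_norm.
rewrite !mulrN !mulNr !opprK.
(* Both sides are gathered into single coefficients, which reduces the equation to an identity of
   integrands. *)
rewrite -(fourier_coefZ l m n _ mhe heH) -(fourier_coefZ l m n _ mce ceC).
rewrite -(fourier_coefD l m n mhhe hheH (C2 := 2 * delta * gamma * H)); last 2 first.
- by apply: measurable_funM.
- move=> x; rewrite normrM; apply: ler_pM => //.
  by rewrite ger0_norm// !mulr_ge0// ltW.
congr fourier_coef; apply/funext => x.
rewrite (mulrA (2 * delta ^+ 2)) -(ig_exponent_quadratic delta gamma)//; rewrite -/(h x); ring.
Unshelve. all: by end_near. Qed.

End Subordination.

(* The first clause is about the generalized Skellam process itself; the second
   one only uses that S is an integer-valued right-continuous process whose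
   state probabilities solve the system. *)
Theorem proposition3p5 (R : realType) (d : measure_display)
  (T : measurableType d) (P : probability T R)
  (k : nat) (hk : (1 <= k)%N) (lam mu : 'I_k -> R)
  (hlam : forall i, 0 < lam i) (hmu : forall i, 0 < mu i)
  (Lam Lambar : R)
  (hLam : Lam = \sum_(i < k) lam i) (hLambar : Lambar = \sum_(i < k) mu i)
  (delta gamma : R) (hdelta : 0 < delta) (hgamma : 0 < gamma)
  (Y : R -> T -> R) (hY : inverse_gaussian_subordinator P delta gamma Y) :
  (forall S : R -> T -> R,
    generalized_skellam_process P lam mu S ->
    skellam_system Lam Lambar (state_prob P S) ->
    independent_processes P S Y ->
    let p := state_prob P (subordinated S Y) in
    forall (n : int) (t : R), 0 < t ->
      [/\ derivable (p n) t 1, derivable (derive1 (p n)) t 1 &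
        derive1n 2 (p n) t - 2 * delta * gamma * derive1 (p n) t =
        - 2 * delta ^+ 2 *
          (Lam * (p (n - 1) t - p n t) - Lambar * (p n t - p (n + 1) t))])
  /\
  (forall S : R -> T -> R,
    measurable_process S -> right_continuous S -> integer_valued S ->
    skellam_system Lam Lambar (state_prob P S) ->
    independent_processes P S Y ->
    let p := state_prob P (subordinated S Y) in
    forall (n : int) (t : R), 0 < t ->
      [/\ derivable (p n) t 1, derivable (derive1 (p n)) t 1 &
        derive1n 2 (p n) t - 2 * delta * gamma * derive1 (p n) t =
        - 2 * delta ^+ 2 *
          (Lam * (p (n - 1) t - p n t) - Lambar * (p n t - p (n + 1) t))]).
Proof.
have sum_gt0 (f : 'I_k -> R) : (forall i, 0 < f i) -> 0 < \sum_(i < k) f i.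
  (* The hypothesis [hk] supplies the index 0, whose term is positive. *)
  move=> f0; rewrite (bigD1 (Ordinal hk))//= ltr_pwDl//.
  by apply: sumr_ge0 => i _; exact: ltW.
have Lam0 : 0 < Lam by rewrite hLam sum_gt0.
have Lambar0 : 0 < Lambar by rewrite hLambar sum_gt0.
split=> [S [M1 [M2 [G1 G2 _ ->]]] sysS indep p n t t0|S mS rS iS sysS indep p n t t0];
  last exact: subordinated_ode.
have [mM1 _ _ _ [rM1 _]] := gcp_levy G1.
have [mM2 _ _ _ [rM2 _]] := gcp_levy G2.
(* Measurability, right continuity and integer values pass from the two counting processes to their
   difference. *)
apply: subordinated_ode => //.
- by move=> s s0; apply: measurable_funB; [exact: mM1|exact: mM2].
- by move=> w s s0; apply: cvgB; [exact: rM1|exact: rM2].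
- move=> s w s0; have [a ->] := gcp_nat G1 w s0; have [b ->] := gcp_nat G2 w s0.
  by exists (a%:Z - b%:Z); rewrite intrB.
Qed.
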